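(* Fix $t_0<0$ and $\alpha>0$. For $\epsilon\in(0,1)$ and $\Delta t>0$ let $t_m=t_0+m\Delta t$ for $m\in\mathbb{N}\cup\{0\}$, and let $\{x(m)\}$ be the solution of $$x(m+1)=-\frac{\Delta t}{\epsilon}x(m)^2+x(m)-\frac{\Delta t}{\epsilon}t_m\quad (m\in\mathbb{N}\cup\{0\}),\qquad x(0)=\sqrt{-t_0}+\alpha\epsilon .$$ Set $$\delta_0=\min\Big\{\frac{\sqrt{-t_0}}{2},\ \frac{1}{3\sqrt{-t_0}},\ \frac{\ln 2}{6}\Big\}.$$ Then there exists a small $\epsilon_0>0$ such that for each pair $(\Delta t,\epsilon)$ with $\Delta t/\epsilon\in(0,\delta_0)$ and $\epsilon\in(0,\epsilon_0)$, two positive constants $c_1,c_2$ can be chosen so that $$x(m)-\sqrt{-t_m}\asymp\frac{\epsilon}{|t_m|}\quad\text{for } m\in\mathbb{N}\text{ such that } t_0\le t_m\le -c_1\epsilon^{2/3},$$ $$x(m)\asymp \epsilon^{1/3}\quad\text{for } m\in\mathbb{N}\text{ such that } -c_1\epsilon^{2/3}\le t_m\le c_2\epsilon^{2/3}.$$ Moreover, $x(m)$ is negative for all $m$ with $t_m>c_2\epsilon^{2/3}$, and $x(m)\to-\infty$ as $m\to\infty$.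
   Context: $\mathbb{N}=\{1,2,\dots\}$. Notation $\asymp$: for two sequences $x_1(m,\epsilon),x_2(m,\epsilon)$ depending on the index $m$ and on the parameter $\epsilon\in(0,\epsilon_0]$, one writes $x_1(m,\epsilon)\asymp x_2(m,\epsilon)$ if there exist two constants $c_\pm>0$ such that $c_-x_2(m,\epsilon)\le x_1(m,\epsilon)\le c_+x_2(m,\epsilon)$ for all $m$ (in the theorem: all $m$ in the indicated range) and all $\epsilon\in(0,\epsilon_0]$.
   Formalization: Negativity of x(m) is proved for t_m > c_3 ε^{2/3} with a separate constant c_3 ≥ c_2 instead of c_2, because some admissible Δt give x(m)=0 with t_m>0, so a single c_2 is impossible; nothing is asserted for c_2 ε^{2/3} < t_m ≤ c_3 ε^{2/3}. *)

(* Defs.v *)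
From Stdlib Require Import Reals.
Open Scope R_scope.

Definition tm (t0 dt : R) (m : nat) : R := t0 + INR m * dt.

Fixpoint euler (t0 alpha dt eps : R) (m : nat) : R :=
  match m with
  | O => sqrt (- t0) + alpha * eps
  | S k => - (dt / eps) * (euler t0 alpha dt eps k) ^ 2
           + euler t0 alpha dt eps k - (dt / eps) * tm t0 dt k
  end.

Definition delta0 (t0 : R) : R :=
  Rmin (sqrt (- t0) / 2) (Rmin (1 / (3 * sqrt (- t0))) (ln 2 / 6)).

Definition admissible (t0 eps0 dt eps : R) : Prop :=
  0 < eps < eps0 /\ 0 < dt / eps < delta0 t0.

(* [P dt eps m] is the range of parameters and indices; the constants
   [cm], [cp] are uniform over that range, in particular in [dt] and [eps]. *)
Definition asymp (P : R -> R -> nat -> Prop) (x1 x2 : R -> R -> nat -> R) : Prop :=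
  exists cm cp : R, 0 < cm /\ 0 < cp /\
    forall (dt eps : R) (m : nat), P dt eps m ->
      cm * x2 dt eps m <= x1 dt eps m <= cp * x2 dt eps m.

(* Why the statement has a constant [c3] for the negativity claim, separate from
   the end point [c2] of the range where [euler] is of order [eps^(1/3)]: for a
   fixed index [m], [euler] is continuous in [dt], so for arbitrarily small [eps]
   some admissible [dt] has [euler t0 alpha dt eps m = 0] with [tm t0 dt m > 0],
   which is neither of order [eps^(1/3)] nor negative; hence [c3 = c2] is
   impossible. *)

(* Main.v *)
(** Put [e = eps^(1/3)], [x = e X], [t = e^2 T].  The scheme becomes
    [X' = X - k (X^2 + T)], [T' = T + k] with the small step [k = dt / e^2], free of
    [eps], and its one-step map is increasing in [X] as long as [2 k X <= 1].  Hence
    discrete sub- and supersolutions trap the orbit: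
    - [sqrt (-T) + c / (-T)] from below and from above (small, resp. large [c]) for
      [T <= -1];
    - the line [(1 - T) / 2] from below for [-1 <= T <= 1/4];
    - the constant [M] and the line [M + 2 - T] from above for [-1 <= T].
    The last line forces negativity and divergence to minus infinity. *)
Require Import Defs.
From Stdlib Require Import Reals Lra.
From Coquelicot Require Import Coquelicot.
Open Scope R_scope.

(** * One-step map and its barriers near the slow curve *)

Definition riccati_step (k t x : R) : R := x - k * (x ^ 2 + t).

(** The images differ by [(y - x) * (1 - k * (x + y))], and [x + y <= 2 * y]; so only the larger
    point needs a bound. *)
Lemma riccati_step_increasing (k t x y : R) :
  0 <= k -> 2 * (k * y) <= 1 -> x <= y ->
  riccati_step k t x <= riccati_step k t y.
Proof.
  intros Hk Hy Hxy; unfold riccati_step.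
  assert (k * (y - x) >= 0) by nra.
  assert (0 <= (y - x) * (1 - k * (x + y))) by (apply Rmult_le_pos; nra).
  nra.
Qed.

(** Here [a] and [b] are the slow curve at consecutive times. It falls by at most [k / a], because
    [k = (a - b) * (a + b)], while the step falls by at least [2 * C * k / a]; hence
    [C >= 1 / 2]. *)
Lemma riccati_supersolution (k a b C : R) :
  0 < k -> 0 < b -> b ^ 2 = a ^ 2 - k -> b <= a -> 1 / 2 <= C ->
  riccati_step k (- a ^ 2) (a + C / a ^ 2) <= b + C / b ^ 2.
Proof.
  intros Hk Hb Hab Hba HC; unfold riccati_step.
  assert (Ha : 0 < a) by lra.
  assert (Hw : C / a ^ 2 <= C / b ^ 2).
  { unfold Rdiv; apply Rmult_le_compat_l; [lra|].
    apply Rinv_le_contravar; nra. }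
  assert (Hdiff : a - b <= k * / a).
  { apply Rmult_le_reg_l with a; [lra|].
    replace (a * (k * / a)) with k by (field; lra); nra. }
  assert (Hwa : C / a ^ 2 * a = C * / a) by (field; lra).
  assert (Hw0 : 0 < C / a ^ 2) by (apply Rdiv_lt_0_compat; nra).
  assert (Hia : 0 < / a) by (apply Rinv_0_lt_compat; lra).
  set (w := C / a ^ 2) in *.
  replace ((a + w) ^ 2 + - a ^ 2) with (2 * (w * a) + w ^ 2) by ring.
  rewrite Hwa.
  assert (0 <= k * w ^ 2) by nra.
  assert (k * / a <= k * (2 * (C * / a))) by (apply Rmult_le_compat_l; nra).
  nra.
Qed.

(** The slow curve falls by at least [k / (2 * a)]. The step costs at most [(2 * c + c ^ 2) * k / a]
    and the growth of the correction at most [c * k / a]; for [c <= 1 / 8] the sum [3 * c + c ^ 2]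
    stays below [1 / 2]. *)
Lemma riccati_subsolution (k a b c : R) :
  0 < k -> 1 <= b -> b ^ 2 = a ^ 2 - k -> b <= a -> 0 <= c <= 1 / 8 ->
  b + c / b ^ 2 <= riccati_step k (- a ^ 2) (a + c / a ^ 2).
Proof.
  intros Hk Hb Hab Hba Hc; unfold riccati_step.
  assert (Ha : 1 <= a) by lra.
  assert (Hia : 0 < / a) by (apply Rinv_0_lt_compat; lra).
  assert (Hdiff : k * / a * (1 / 2) <= a - b).
  { apply Rmult_le_reg_l with a; [lra|].
    replace (a * (k * / a * (1 / 2))) with (k / 2) by (field; lra); nra. }
  assert (Hjump : c / b ^ 2 - c / a ^ 2 = k * / a * (c / (b ^ 2 * a))).
  { replace k with (a ^ 2 - b ^ 2) by lra; field; lra. }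
  assert (Hjc : c / (b ^ 2 * a) <= c).
  { unfold Rdiv; rewrite <- (Rmult_1_r c) at 2.
    apply Rmult_le_compat_l; [lra|].
    rewrite <- Rinv_1; apply Rinv_le_contravar; nra. }
  assert (Hwa : c / a ^ 2 * a = c * / a) by (field; lra).
  assert (Hww : (c / a ^ 2) ^ 2 = c ^ 2 * / a * / a ^ 3) by (field; lra).
  assert (Ha3 : / a ^ 3 <= 1).
  { rewrite <- Rinv_1; apply Rinv_le_contravar; nra. }
  assert (Hka : 0 < k * / a) by nra.
  assert (Hsq : k * (c / a ^ 2) ^ 2 <= k * / a * c ^ 2).
  { rewrite Hww.
    replace (k * (c ^ 2 * / a * / a ^ 3)) with (k * / a * c ^ 2 * / a ^ 3) by ring.
    assert (0 <= k * / a * c ^ 2) by nra.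
    nra. }
  set (w := c / a ^ 2) in *.
  replace (k * ((a + w) ^ 2 + - a ^ 2)) with (2 * k * (w * a) + k * w ^ 2) by ring.
  rewrite Hwa.
  set (q := k * / a) in *.
  replace (2 * k * (c * / a)) with (2 * c * q) by (unfold q; ring).
  assert (q * (c / (b ^ 2 * a)) <= q * c) by (apply Rmult_le_compat_l; lra).
  assert (q * (3 * c + c ^ 2) <= q * (1 / 2)) by (apply Rmult_le_compat_l; nra).
  nra.
Qed.

(** * Trapping the rescaled orbit *)

(* [c] and [C] compare the initial deviation from the slow curve [X = sqrt (-T)] with
   [1 / (-T)]; the last two fields keep the orbit where the one-step map increases. *)
Record scaled_orbit (k c C : R) (X T : nat -> R) : Prop := {
  orbit_X : forall m, X (S m) = riccati_step k (T m) (X m);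
  orbit_T : forall m, T (S m) = T m + k;
  orbit_k : 0 < k <= 1;
  orbit_c : 0 < c <= 1 / 8;
  orbit_C : 1 / 2 <= C;
  orbit_T0 : T 0%nat <= - 1;
  orbit_X0 : sqrt (- T 0%nat) + c / (- T 0%nat) <= X 0%nat
             <= sqrt (- T 0%nat) + C / (- T 0%nat);
  orbit_slow : k * sqrt (- T 0%nat) <= 1 / 3;
  orbit_small : k * (C + 2) <= 1 / 6 }.

Section ScaledOrbit.

Context {k c C : R} {X T : nat -> R} (H : scaled_orbit k c C X T).

Lemma orbit_T_ge (m : nat) : T 0%nat <= T m.
Proof.
  induction m as [|m IH]; [lra|].
  rewrite (orbit_T _ _ _ _ _ H); pose proof (orbit_k _ _ _ _ _ H); lra.
Qed.

Lemma orbit_slow_curve (m : nat) : T m <= - 1 ->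
  sqrt (- T m) + c / (- T m) <= X m <= sqrt (- T m) + C / (- T m).
Proof.
  destruct H as [HX HT Hk Hc HC HT0 HX0 Hslow Hsmall].
  induction m as [|m IH]; intros Hm; [exact HX0|].
  rewrite HT in Hm; assert (Hm' : T m <= - 1) by lra.
  destruct (IH Hm') as [IHl IHu].
  rewrite HX, HT.
  set (a := sqrt (- T m)) in *; set (b := sqrt (- (T m + k))).
  assert (Ha2 : a ^ 2 = - T m) by (apply pow2_sqrt; lra).
  assert (Hb2 : b ^ 2 = - (T m + k)) by (apply pow2_sqrt; lra).
  assert (Hba : b <= a) by (apply sqrt_le_1_alt; lra).
  assert (Hb1 : 1 <= b) by (rewrite <- sqrt_1; apply sqrt_le_1_alt; lra).
  assert (Ha0 : a <= sqrt (- T 0%nat)).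
  { apply sqrt_le_1_alt; pose proof (orbit_T_ge m); lra. }
  (* The bounds [k * a <= 1 / 3] and [k * C <= 1 / 6] add up to exactly [1 / 2]. *)
  assert (Hmono : 2 * (k * (a + C / a ^ 2)) <= 1).
  { assert (C / a ^ 2 <= C).
    { unfold Rdiv; rewrite <- (Rmult_1_r C) at 2.
      apply Rmult_le_compat_l; [lra|].
      rewrite <- Rinv_1; apply Rinv_le_contravar; nra. }
    assert (k * a <= k * sqrt (- T 0%nat)) by (apply Rmult_le_compat_l; lra).
    assert (k * (C / a ^ 2) <= k * C) by (apply Rmult_le_compat_l; lra).
    nra. }
  rewrite <- Ha2 in IHl, IHu; rewrite <- Hb2.
  replace (T m) with (- a ^ 2) by lra.
  split.
  - apply Rle_trans with (riccati_step k (- a ^ 2) (a + c / a ^ 2)).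
    + apply riccati_subsolution; lra.
    + apply riccati_step_increasing; [lra| |exact IHl].
      assert (k * X m <= k * (a + C / a ^ 2)) by (apply Rmult_le_compat_l; lra).
      lra.
  - apply Rle_trans with (riccati_step k (- a ^ 2) (a + C / a ^ 2)).
    + apply riccati_step_increasing; lra.
    + apply riccati_supersolution; lra.
Qed.

(** Handover from the slow curve to the fold: since [k <= 1], the last time before [T] passes [-1]
    lies in this window. *)
Lemma orbit_entry (m : nat) : - 2 <= T m <= - 1 -> 1 <= X m <= C + 2.
Proof.
  intros Hm; destruct (orbit_slow_curve m) as [Hl Hu]; [lra|].
  pose proof (orbit_c _ _ _ _ _ H); pose proof (orbit_C _ _ _ _ _ H).
  assert (1 <= sqrt (- T m)) by (rewrite <- sqrt_1; apply sqrt_le_1_alt; lra).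
  assert (sqrt (- T m) <= 2).
  { rewrite <- (sqrt_pow2 2) by lra; apply sqrt_le_1_alt; lra. }
  assert (0 < c / - T m) by (apply Rdiv_lt_0_compat; lra).
  assert (C / - T m <= C).
  { unfold Rdiv; rewrite <- (Rmult_1_r C) at 2.
    apply Rmult_le_compat_l; [lra|].
    rewrite <- Rinv_1; apply Rinv_le_contravar; lra. }
  lra.
Qed.

Lemma orbit_upper (m : nat) : - 1 <= T m ->
  X m <= C + 2 /\ X m <= C + 4 - T m.
Proof.
  pose proof orbit_entry as Hentry.
  destruct H as [HX HT Hk Hc HC HT0 HX0 Hslow Hsmall].
  induction m as [|m IH]; intros Hm.
  - assert (X 0%nat <= C + 2) by (apply Hentry; lra); lra.
  - rewrite HT in Hm |- *.
    assert (Hbound : X m <= C + 2).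
    { destruct (Rle_dec (- 1) (T m)); [now apply IH|apply Hentry; lra]. }
    assert (Hnext : X (S m) <= C + 2).
    { rewrite HX; apply Rle_trans with (riccati_step k (T m) (C + 2)).
      - apply riccati_step_increasing; lra.
      - unfold riccati_step; assert (0 <= (C + 2) ^ 2 + T m) by nra; nra. }
    split; [exact Hnext|].
    (* If [T m <= 1], the next time is at most [2], where the line is still above [C + 2].
       Afterwards [X ^ 2 + T >= 1], so each step falls at least as fast as the line of slope
       [-1]. *)
    destruct (Rle_dec (T m) 1) as [HT1|HT1]; [lra|].
    destruct IH as [_ IH]; [lra|].
    rewrite HX; unfold riccati_step; assert (1 <= X m ^ 2 + T m) by nra; nra.
Qed.

(** On the line, [X ^ 2 + T = ((1 + T) / 2) ^ 2], which is at most [25 / 64] up to [T = 1 / 4]; a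
    fall of slope [-1 / 2] therefore stays below the orbit. *)
Lemma orbit_lower (m : nat) : - 1 <= T m <= 1 / 4 -> (1 - T m) / 2 <= X m.
Proof.
  pose proof orbit_entry as Hentry; pose proof orbit_upper as Hup.
  destruct H as [HX HT Hk Hc HC HT0 HX0 Hslow Hsmall].
  induction m as [|m IH]; intros Hm.
  - assert (1 <= X 0%nat) by (apply Hentry; lra); lra.
  - rewrite HT in Hm |- *; rewrite HX.
    destruct (Rle_dec (- 1) (T m)) as [Hm1|Hm1].
    + specialize (IH ltac:(lra)); destruct (Hup m Hm1) as [Hu _].
      assert (k * X m <= k * (C + 2)) by (apply Rmult_le_compat_l; lra).
      apply Rle_trans with (riccati_step k (T m) ((1 - T m) / 2)).
      * unfold riccati_step.
        assert (((1 - T m) / 2) ^ 2 + T m <= 1 / 2) by nra; nra.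
      * apply riccati_step_increasing; lra.
    + destruct (Hentry m) as [Hl Hu]; [lra|].
      assert (k * X m <= k * (C + 2)) by (apply Rmult_le_compat_l; lra).
      apply Rle_trans with (riccati_step k (T m) 1).
      * unfold riccati_step; assert (1 ^ 2 + T m <= 0) by lra; nra.
      * apply riccati_step_increasing; lra.
Qed.

End ScaledOrbit.

(** * Rescaling the Euler scheme *)

Lemma euler_S (t0 alpha dt eps : R) (m : nat) :
  euler t0 alpha dt eps (S m)
  = riccati_step (dt / eps) (tm t0 dt m) (euler t0 alpha dt eps m).
Proof. unfold riccati_step; cbn [euler]; ring. Qed.

Lemma euler_scaled_orbit (t0 alpha h e : R) :
  t0 < 0 -> 0 < alpha -> 0 < e < 1 -> e <= sqrt (- t0) ->
  0 < h <= 1 -> h * sqrt (- t0) <= 1 / 3 ->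
  e * (Rmax (1 / 2) (alpha * - t0) + 2) <= 1 / 6 ->
  scaled_orbit (h * e) (Rmin (1 / 8) (alpha * - t0)) (Rmax (1 / 2) (alpha * - t0))
    (fun m => euler t0 alpha (h * e ^ 3) (e ^ 3) m / e)
    (fun m => tm t0 (h * e ^ 3) m / e ^ 2).
Proof.
  intros Ht0 Halpha He Hes Hh Hhs HeC.
  assert (He2 : 0 < e ^ 2) by nra.
  assert (Hat : 0 < alpha * - t0) by nra.
  assert (Hs2 : sqrt (- t0) ^ 2 = - t0) by (apply pow2_sqrt; lra).
  assert (HT0 : tm t0 (h * e ^ 3) 0 / e ^ 2 = t0 / e ^ 2).
  { unfold tm; simpl INR; f_equal; ring. }
  assert (Hsq : sqrt (- (t0 / e ^ 2)) = sqrt (- t0) / e).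
  { replace (- (t0 / e ^ 2)) with ((sqrt (- t0) / e) ^ 2).
    2: { transitivity (sqrt (- t0) ^ 2 / e ^ 2); [|rewrite Hs2]; field; lra. }
    apply sqrt_pow2, Rle_div_r; pose proof (sqrt_pos (- t0)); lra. }
  constructor.
  - intros m; rewrite euler_S; unfold riccati_step; field; lra.
  - intros m; unfold tm; rewrite S_INR; field; lra.
  - nra.
  - split; [apply Rmin_glb_lt; lra|apply Rmin_l].
  - apply Rmax_l.
  - rewrite HT0; apply Rle_div_l; [lra|nra].
  - rewrite HT0, Hsq; cbn [euler].
    (* The initial deviation is exactly [alpha * - t0] times [1 / (- T 0)], whatever [e] is, so [c]
       and [C] can be uniform. *)
    replace ((sqrt (- t0) + alpha * e ^ 3) / e)
      with (sqrt (- t0) / e + alpha * - t0 / - (t0 / e ^ 2)) by (field; lra).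
    assert (Hd0 : 0 <= / - (t0 / e ^ 2)).
    { left; apply Rinv_0_lt_compat.
      replace (- (t0 / e ^ 2)) with (- t0 / e ^ 2) by (field; lra).
      apply Rdiv_lt_0_compat; lra. }
    split; apply Rplus_le_compat_l; (apply Rmult_le_compat_r; [exact Hd0|]).
    + apply Rmin_r.
    + apply Rmax_r.
  - rewrite HT0, Hsq.
    (* The factor [e] cancels: this bound comes from the restriction on [dt / eps], not from small
       [eps]. *)
    replace (h * e * (sqrt (- t0) / e)) with (h * sqrt (- t0)) by (field; lra); lra.
  - pose proof (Rmax_l (1 / 2) (alpha * - t0)); nra.
Qed.

Lemma delta0_bounds (t0 h : R) : t0 < 0 -> 0 < h < delta0 t0 ->
  h <= 1 /\ h * sqrt (- t0) <= 1 / 3.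
Proof.
  intros Ht0 [Hh0 Hh]; unfold delta0 in Hh.
  apply Rmin_Rgt_l in Hh; destruct Hh as [_ Hh].
  apply Rmin_Rgt_l in Hh; destruct Hh as [Hh1 Hh2].
  assert (Hs : 0 < sqrt (- t0)) by (apply sqrt_lt_R0; lra).
  assert (Hln : ln 2 < 1).
  { rewrite <- (ln_exp 1); apply ln_increasing; [lra|].
    pose proof (exp_ineq1 1); lra. }
  split; [lra|].
  apply Rle_trans with (1 / (3 * sqrt (- t0)) * sqrt (- t0)).
  - apply Rmult_le_compat_r; lra.
  - right; field; lra.
Qed.

Lemma tm_unbounded (t0 dt B : R) : 0 < dt ->
  exists N, forall n, (N <= n)%nat -> B < tm t0 dt n.
Proof.
  intros Hdt; destruct (INR_unbounded ((B - t0) / dt)) as [N HN].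
  exists N; intros n Hn; apply le_INR in Hn; unfold tm.
  apply Rlt_div_l in HN; [|lra]; nra.
Qed.

(** * Uniform constants and return to the original variables *)

Theorem theorem1 (t0 alpha : R) (ht0 : t0 < 0) (halpha : 0 < alpha) :
  exists eps0 c1 c2 c3 : R,
    0 < eps0 < 1 /\ 0 < c1 /\ 0 < c2 <= c3 /\
    asymp
      (fun dt eps m => admissible t0 eps0 dt eps /\ (1 <= m)%nat /\
         t0 <= tm t0 dt m <= - (c1 * Rpower eps (2 / 3)))
      (fun dt eps m => euler t0 alpha dt eps m - sqrt (- tm t0 dt m))
      (fun dt eps m => eps / Rabs (tm t0 dt m)) /\
    asymp
      (fun dt eps m => admissible t0 eps0 dt eps /\ (1 <= m)%nat /\
         - (c1 * Rpower eps (2 / 3)) <= tm t0 dt m <= c2 * Rpower eps (2 / 3))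
      (fun dt eps m => euler t0 alpha dt eps m)
      (fun dt eps m => Rpower eps (1 / 3)) /\
    (forall dt eps : R, admissible t0 eps0 dt eps ->
       (forall m : nat, c3 * Rpower eps (2 / 3) < tm t0 dt m ->
          euler t0 alpha dt eps m < 0) /\
       is_lim_seq (euler t0 alpha dt eps) m_infty).
Proof.
  set (c := Rmin (1 / 8) (alpha * - t0)).
  set (C := Rmax (1 / 2) (alpha * - t0)).
  assert (Hat : 0 < alpha * - t0) by nra.
  assert (Hc : 0 < c) by (apply Rmin_glb_lt; lra).
  assert (HC : 1 / 2 <= C) by apply Rmax_l.
  assert (Hs : 0 < sqrt (- t0)) by (apply sqrt_lt_R0; lra).
  (* The three entries ensure [eps0 < 1], initial scaled time at most [-1], and
     [k * (C + 2) <= 1 / 6]. *)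
  set (e0 := Rmin (1 / 2) (Rmin (sqrt (- t0)) (/ (6 * (C + 2))))).
  assert (He0 : 0 < e0).
  { repeat apply Rmin_glb_lt; try lra; apply Rinv_0_lt_compat; lra. }
  assert (He0l : e0 <= 1 / 2) by apply Rmin_l.
  assert (He0s : e0 <= sqrt (- t0)).
  { eapply Rle_trans; [apply Rmin_r|apply Rmin_l]. }
  assert (He0C : e0 * (C + 2) <= 1 / 6).
  { apply Rle_trans with (/ (6 * (C + 2)) * (C + 2)).
    - apply Rmult_le_compat_r; [lra|].
      eapply Rle_trans; [apply Rmin_r|apply Rmin_r].
    - right; field; lra. }
  assert (Hscale : forall dt eps, admissible t0 (e0 ^ 3) dt eps ->
    exists h e, 0 < h /\ 0 < e /\ dt = h * e ^ 3 /\ eps = e ^ 3 /\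
      Rpower eps (1 / 3) = e /\ Rpower eps (2 / 3) = e ^ 2 /\
      scaled_orbit (h * e) c C (fun m => euler t0 alpha dt eps m / e)
        (fun m => tm t0 dt m / e ^ 2)).
  { intros dt eps [Heps Hh].
    set (e := Rpower eps (1 / 3)).
    assert (He : 0 < e) by apply exp_pos.
    assert (He3 : e ^ 3 = eps).
    { unfold e; rewrite <- Rpower_pow by apply exp_pos; rewrite Rpower_mult.
      replace (1 / 3 * INR 3) with 1 by (simpl; field); apply Rpower_1; lra. }
    assert (He2 : Rpower eps (2 / 3) = e ^ 2).
    { unfold e; rewrite <- (Rpower_pow 2) by apply exp_pos; rewrite Rpower_mult.
      f_equal; simpl; field. }
    assert (Hee0 : e < e0).
    { apply Rnot_le_lt; intros Hle.
      assert (e0 ^ 3 <= e ^ 3) by (apply pow_incr; lra); lra. }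
    destruct (delta0_bounds _ _ ht0 Hh) as [Hh1 Hhs].
    exists (dt / eps), e.
    assert (Hdt : dt = dt / eps * e ^ 3) by (rewrite He3; field; lra).
    split; [lra|]; do 5 (split; [easy|]).
    pose proof (euler_scaled_orbit t0 alpha (dt / eps) e ht0 halpha) as Horb.
    rewrite <- Hdt, He3 in Horb; apply Horb; try lra.
    apply Rle_trans with (e0 * (C + 2)); [apply Rmult_le_compat_r|]; unfold C in *; lra. }
  (* The scaled times [-1] and [1 / 4] bound the range of the lower line, and [C + 4] is the zero of
     the upper line. *)
  exists (e0 ^ 3), 1, (1 / 4), (C + 4).
  split; [|split; [lra|split; [lra|split; [|split]]]].
  - split; [now apply pow_lt|].
    apply Rle_lt_trans with ((1 / 2) ^ 3); [apply pow_incr|]; lra.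
  - exists c, C; split; [exact Hc|split; [lra|]].
    intros dt eps m [Hadm [_ [_ Hm]]].
    destruct (Hscale dt eps Hadm) as (h & e & Hh & He & _ & Heps & _ & He2 & Horb).
    rewrite He2 in Hm.
    assert (Hp : 0 < e ^ 2) by nra.
    assert (HT : tm t0 dt m / e ^ 2 <= - 1) by (apply Rle_div_l; lra).
    destruct (orbit_slow_curve Horb m HT) as [Hl Hu].
    rewrite Rabs_left by lra.
    assert (Hsq : sqrt (- tm t0 dt m) = e * sqrt (- (tm t0 dt m / e ^ 2))).
    { rewrite <- (sqrt_pow2 e) at 1 by lra; rewrite <- sqrt_mult_alt by lra.
      f_equal; field; lra. }
    assert (Hdev : forall d, e * (d / - (tm t0 dt m / e ^ 2))
                             = d * (eps / - tm t0 dt m)).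
    { intros d; rewrite Heps; field; lra. }
    rewrite <- !Hdev, Hsq.
    replace (euler t0 alpha dt eps m) with (e * (euler t0 alpha dt eps m / e))
      by (field; lra).
    split; nra.
  (* [3 / 8] is the value of [(1 - T) / 2] at [T = 1 / 4]. *)
  - exists (3 / 8), (C + 2); split; [lra|split; [lra|]].
    intros dt eps m [Hadm [_ Hm]].
    destruct (Hscale dt eps Hadm) as (h & e & Hh & He & _ & _ & He1 & He2 & Horb).
    rewrite He2 in Hm; rewrite He1.
    assert (Hp : 0 < e ^ 2) by nra.
    assert (HT : - 1 <= tm t0 dt m / e ^ 2 <= 1 / 4).
    { split; [apply Rle_div_r|apply Rle_div_l]; lra. }
    pose proof (orbit_lower Horb m HT) as Hl.
    destruct (orbit_upper Horb m (proj1 HT)) as [Hu _].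
    split; [apply Rle_div_r; lra|apply Rle_div_l; lra].
  - intros dt eps Hadm.
    destruct (Hscale dt eps Hadm) as (h & e & Hh & He & Hdt & _ & _ & He2 & Horb).
    assert (Hp : 0 < e ^ 2) by nra.
    assert (Hdt0 : 0 < dt) by (rewrite Hdt; assert (0 < e ^ 3) by (apply pow_lt; lra); nra).
    (* [B = 0] gives negativity, [B = Rabs M / e] divergence. *)
    assert (Hneg : forall m B, 0 <= B -> (C + 4 + B) * e ^ 2 < tm t0 dt m ->
              euler t0 alpha dt eps m < - B * e).
    { intros m B HB Hm; apply Rlt_div_r in Hm; [|lra].
      destruct (orbit_upper Horb m) as [_ Hu]; [lra|].
      apply Rlt_div_l; lra. }
    split.
    + intros m Hm; rewrite He2 in Hm.
      specialize (Hneg m 0 ltac:(lra)); lra.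
    + apply is_lim_seq_spec; intros M.
      destruct (tm_unbounded t0 dt ((C + 4 + Rabs M / e) * e ^ 2) Hdt0) as [N HN].
      exists N; intros n Hn.
      assert (HB : 0 <= Rabs M / e) by (apply Rle_div_r; pose proof (Rabs_pos M); lra).
      specialize (Hneg n _ HB (HN n Hn)).
      replace (- (Rabs M / e) * e) with (- Rabs M) in Hneg by (field; lra).
      pose proof (Rabs_maj2 M); lra.
Qed.
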